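(* Let $F$ be $\ell$-star-cocoercive and let $X^*=\{x^*\}$ be a singleton. Then SEGA-SGDA satisfies the key parametric assumption with $\sigma_k^2=\|h^k-F(x^* )\|^2$ and $$A=d\ell,\quad B=2d,\quad D_1=0,\quad C=\frac{\ell}{2d},\quad\rho=\frac1d,\quad D_2=0.$$
   Context: Norms and inner products on $\mathbb{R}^d$ are Euclidean. $F:\mathbb{R}^d\to\mathbb{R}^d$ is an operator and $R:\mathbb{R}^d\to\mathbb{R}\cup\{+\infty\}$ is a proper lower semicontinuous convex function. $X^*$ is the (nonempty) set of solutions of the regularized variational inequality: find $x^*\in\mathbb{R}^d$ with $\langle F(x^* ),x-x^*\rangle+R(x)-R(x^* )\ge0$ for all $x\in\mathbb{R}^d$. $\mathrm{proj}_{X^*}(x)=\arg\min_{y\in X^*}\|y-x\|$. $F$ is $\ell$-star-cocoercive ($\ell>0$) if $\|F(x)-F(x^* )\|^2\le\ell\langle F(x)-F(x^* ),x-x^*\rangle$ for all $x$, where $x^*=\mathrm{proj}_{X^*}(x)$. $[x]_j$ is the $j$-th component of $x$ and $e_1,\dots,e_d$ is the standard basis of $\mathbb{R}^d$. SEGA-SGDA, with $\gamma>0$, $x^0\in\mathbb{R}^d$, $h^0=0$: at each iteration $k\ge0$ sample $j$ uniformly from $\{1,\dots,d\}$ (freshly) and set $$h^{k+1}=h^k+e_j([F(x^k)]_j-[h^k]_j),\quad g^k=d\,e_j([F(x^k)]_j-[h^k]_j)+h^k,\quad x^{k+1}=\mathrm{prox}_{\gamma R}(x^k-\gamma g^k),$$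 where $\mathrm{prox}_{\gamma R}(x)=\arg\min_{y}\{R(y)+\|y-x\|^2/(2\gamma)\}$. Put $x^{*,k}=\mathrm{proj}_{X^*}(x^k)$ and $g^{*,k}=F(x^{*,k})$. $\mathbb{E}_k[\cdot]$ is the expectation with respect to the randomness at iteration $k$, i.e. conditional on everything generated before iteration $k$ (in particular on $x^k,h^k$). Key parametric assumption (with constants $A,B,C,D_1,D_2\ge0$, $\rho\in(0,1]$ and nonnegative variables $\sigma_k$): for all $k\ge0$, $\mathbb{E}_k[g^k]=F(x^k)$ and $$\mathbb{E}_k\|g^k-g^{*,k}\|^2\le2A\langle F(x^k)-g^{*,k},x^k-x^{*,k}\rangle+B\sigma_k^2+D_1,$$ $$\mathbb{E}_k[\sigma_{k+1}^2]\le2C\langle F(x^k)-g^{*,k},x^k-x^{*,k}\rangle+(1-\rho)\sigma_k^2+D_2.$$ *)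

(* Defs.v *)
From HB Require Import structures.
From mathcomp Require Import all_boot all_order all_algebra.
From mathcomp Require Import all_classical all_reals all_analysis.

Set Implicit Arguments.
Unset Strict Implicit.
Unset Printing Implicit Defensive.
Import Order.TTheory GRing.Theory Num.Theory numFieldNormedType.Exports.
Local Open Scope classical_set_scope.
Local Open Scope ring_scope.

(* R^d is 'rV[R]_d.  The norm [`|u|] that MathComp-Analysis puts on row vectors
   is the sup norm, so the Euclidean structure is defined here; both norms
   induce the topology used by [lower_semicontinuous]. *)
Definition dotp {R : realType} {d : nat} (u v : 'rV[R]_d) : R :=
  \sum_(i < d) u ord0 i * v ord0 i.

Definition enorm {R : realType} {d : nat} (u : 'rV[R]_d) : R :=
  Num.sqrt (dotp u u).

(* The codomain \bar R also contains -oo, excluded here. *)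
Definition proper_fun {R : realType} {T : Type} (f : T -> \bar R) : Prop :=
  (forall x, (-oo < f x)%E) /\ (exists x, (f x < +oo)%E).

(* Convention of the library: 0 * +oo = 0, so t = 0 and t = 1 are harmless. *)
Definition convex_efun {R : realType} {d : nat} (f : 'rV[R]_d -> \bar R) : Prop :=
  forall (x y : 'rV[R]_d) (t : R), 0 <= t <= 1 ->
    (f (t *: x + (1 - t) *: y)%R <= t%:E * f x + (1 - t)%R%:E * f y)%E.

(* A minimizer of [f] over [A]; the junk value 0 is returned only if none
   exists. *)
Definition argmin {R : realType} {d : nat} (A : set 'rV[R]_d)
    (f : 'rV[R]_d -> \bar R) : 'rV[R]_d :=
  xget 0 [set y | A y /\ forall z, A z -> (f y <= f z)%E].

Definition euclid_proj {R : realType} {d : nat} (A : set 'rV[R]_d) (x : 'rV[R]_d) :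
    'rV[R]_d :=
  argmin A (fun y => (enorm (y - x))%:E).

(* [prox gamma r] is prox_{gamma r}. *)
Definition prox {R : realType} {d : nat} (gamma : R) (r : 'rV[R]_d -> \bar R)
    (x : 'rV[R]_d) : 'rV[R]_d :=
  argmin setT (fun y => r y + (enorm (y - x) ^+ 2 / (2 * gamma))%R%:E)%E.

(* Convention of the library: +oo - +oo = -oo.  Hence, for [r] proper, a
   solution automatically satisfies r xs < +oo. *)
Definition vi_solutions {R : realType} {d : nat} (F : 'rV[R]_d -> 'rV[R]_d)
    (r : 'rV[R]_d -> \bar R) : set 'rV[R]_d :=
  [set xs | forall x, (0 <= (dotp (F xs) (x - xs))%R%:E + r x - r xs)%E].

Definition star_cocoercive {R : realType} {d : nat} (F : 'rV[R]_d -> 'rV[R]_d)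
    (Xs : set 'rV[R]_d) (ell : R) : Prop :=
  forall x, let xs := euclid_proj Xs x in
    enorm (F x - F xs) ^+ 2 <= ell * dotp (F x - F xs) (x - xs).

Section sega.
Context {R : realType} {d : nat}.
Variables (F : 'rV[R]_d -> 'rV[R]_d) (r : 'rV[R]_d -> \bar R) (gamma : R).
Variable x0 : 'rV[R]_d.

Definition sega_h_step (x h : 'rV[R]_d) (j : 'I_d) : 'rV[R]_d :=
  h + (F x ord0 j - h ord0 j) *: delta_mx ord0 j.

Definition sega_estimator (x h : 'rV[R]_d) (j : 'I_d) : 'rV[R]_d :=
  (d%:R * (F x ord0 j - h ord0 j)) *: delta_mx ord0 j + h.

(* The pair (x^k, h^k) along the sequence [j] of sampled coordinates. *)
Fixpoint sega_state (j : nat -> 'I_d) (k : nat) : 'rV[R]_d * 'rV[R]_d :=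
  if k is k'.+1 then
    let: (x, h) := sega_state j k' in
    (prox gamma r (x - gamma *: sega_estimator x h (j k')),
     sega_h_step x h (j k'))
  else (x0, 0).

Context {Omega : Type}.
Variable j : nat -> Omega -> 'I_d.

Definition sega_x (k : nat) (w : Omega) : 'rV[R]_d :=
  (sega_state (fun n => j n w) k).1.

Definition sega_h (k : nat) (w : Omega) : 'rV[R]_d :=
  (sega_state (fun n => j n w) k).2.

Definition sega_g (k : nat) (w : Omega) : 'rV[R]_d :=
  sega_estimator (sega_x k w) (sega_h k w) (j k w).

End sega.

(* Mutual independence is the product rule over every finite subfamily ('I_d
   carries the discrete sigma-algebra). *)
Definition iid_uniform {R : realType} {disp : measure_display}
    {Omega : measurableType disp} (P : probability Omega R) {d : nat}
    (j : nat -> Omega -> 'I_d) : Prop :=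
  [/\ forall n (B : set 'I_d), measurable (j n @^-1` B),
      forall n (i : 'I_d), P (j n @^-1` [set i]) = (d%:R^-1)%:E
    & forall (K : seq nat) (B : nat -> set 'I_d), uniq K ->
        P (\big[setI/setT]_(n <- K) (j n @^-1` B n)) =
        (\prod_(n <- K) P (j n @^-1` B n))%E].

(* sigma(j_0, ..., j_{k-1}) *)
Definition history {Omega : Type} {d : nat} (j : nat -> Omega -> 'I_d)
    (k : nat) : set (set Omega) :=
  <<s [set A | exists n (B : set 'I_d), (n < k)%N /\ A = j n @^-1` B] >>.

(* [Z] is a version of the conditional expectation E[Y | G]. *)
Definition is_condexp {R : realType} {disp : measure_display}
    {Omega : measurableType disp} (P : probability Omega R)
    (G : set (set Omega)) (Y Z : Omega -> R) : Prop :=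
  [/\ P.-integrable setT (EFin \o Y),
      P.-integrable setT (EFin \o Z),
      forall B : set R, measurable B -> G (Z @^-1` B)
    & forall A, G A ->
        (\int[P]_(w in A) (Y w)%:E = \int[P]_(w in A) (Z w)%:E)%E].

(* E[Y | G] <= W almost surely.  Versions of E[Y | G] agree almost surely, so
   the choice of version is immaterial. *)
Definition condexp_le {R : realType} {disp : measure_display}
    {Omega : measurableType disp} (P : probability Omega R)
    (G : set (set Omega)) (Y W : Omega -> R) : Prop :=
  exists2 Z : Omega -> R, is_condexp P G Y Z & {ae P, forall w, Z w <= W w}.

(* [G k] is the information available before iteration k, so that E_k is the
   conditional expectation given [G k]; for vectors it is taken
   componentwise. *)
Definition key_parametric_assumption {R : realType} {disp : measure_display}
    {Omega : measurableType disp} (P : probability Omega R)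
    (G : nat -> set (set Omega)) {d : nat}
    (F : 'rV[R]_d -> 'rV[R]_d) (Xs : set 'rV[R]_d)
    (x g : nat -> Omega -> 'rV[R]_d) (sigma : nat -> Omega -> R)
    (A B C D1 D2 rho : R) : Prop :=
  let xs k w := euclid_proj Xs (x k w) in
  let gs k w := F (xs k w) in
  let gap k w := dotp (F (x k w) - gs k w) (x k w - xs k w) in
  [/\ [/\ 0 <= A, 0 <= B, 0 <= C, 0 <= D1 & 0 <= D2],
      0 < rho <= 1,
      forall k w, 0 <= sigma k w
    & forall k,
      [/\ forall i : 'I_d, is_condexp P (G k)
            (fun w => g k w ord0 i) (fun w => F (x k w) ord0 i),
          condexp_le P (G k) (fun w => enorm (g k w - gs k w) ^+ 2)
            (fun w => 2 * A * gap k w + B * sigma k w ^+ 2 + D1)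
        & condexp_le P (G k) (fun w => sigma k.+1 w ^+ 2)
            (fun w => 2 * C * gap k w + (1 - rho) * sigma k w ^+ 2 + D2)]].

(* Main.v *)
Require Import Defs.
From HB Require Import structures.
From mathcomp Require Import all_boot all_order all_algebra.
From mathcomp Require Import all_classical all_reals all_analysis.
From mathcomp Require Import ring lra.
Import Order.TTheory GRing.Theory Num.Theory numFieldNormedType.Exports.
Local Open Scope classical_set_scope.
Local Open Scope ring_scope.

(** At step k the state (x, h) is a function of the samples j_0, ..., j_{k-1},
    hence takes finitely many values, and j_k is uniform and independent of it.
    So E_k[phi((x, h), j_k)] is the average of phi((x, h), i) over i.  With
    a = F(x) - F(xs) and b = h - F(xs), these averages are
      E_k |g - F(xs)|^2  = d |a - b|^2 + 2 <a - b, b> + |b|^2,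
      E_k |h' - F(xs)|^2 = |a|^2 / d + (1 - 1/d) |b|^2,
    the first of which is at most 2d |a|^2 + 2d |b|^2, the gap being
    (d - 1) |a + b|^2 + |a|^2 + 2 |b|^2.  Star-cocoercivity bounds |a|^2 by
    ell <a, x - xs>. *)

(** * Integration of functions of a finite-valued random variable *)

Section finite_valued.
Context {R : realType} {disp : measure_display} {Omega : measurableType disp}.
Context (P : probability Omega R) {T : finType} (U : Omega -> T).
Hypothesis mU : forall t, measurable (U @^-1` [set t]).
Variable f : T -> R.

(** At each [w] only the fiber through [w] contributes. Integrability and the integral formula then
    follow by linearity from indicators. *)
Let f_indic : EFin \o (f \o U) =
  (fun w => \sum_(t : T) (f t)%:E * (\1_(U @^-1` [set t]) w)%:E)%E.
Proof.
apply/funext => w /=; rewrite (bigD1 (U w)) //= big1 ?adde0.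
  by rewrite indicE mem_set ?mule1.
by move=> t /eqP tU; rewrite indicE memNset ?mule0// => /= /esym.
Qed.

Lemma integrable_finite_valued : P.-integrable setT (EFin \o (f \o U)).
Proof.
rewrite f_indic; apply: integrable_sum => // t _.
by apply: integrableZl => //; exact: integrable_indic.
Qed.

Lemma integral_finite_valued (A : set Omega) : measurable A ->
  (\int[P]_(w in A) (f (U w))%:E =
   \sum_(t : T) (f t)%:E * P (U @^-1` [set t] `&` A))%E.
Proof.
move=> mA.
have mI t : P.-integrable A (EFin \o \1_(U @^-1` [set t])).
  by apply: (@integrableS _ _ _ _ setT) => //; exact: integrable_indic.
have -> : (fun w => (f (U w))%:E) = EFin \o (f \o U) by [].
rewrite f_indic integral_sum//; last by move=> t; apply: integrableZl => //; exact: mI.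
by apply: eq_bigr => t _; rewrite integralZl// ?integral_indic//; exact: mI.
Qed.

End finite_valued.

(** * Conditional expectation given the past samples, the current one being fresh *)

Section fresh_sample.
Context {R : realType} {disp : measure_display} {Omega : measurableType disp}.
Context (P : probability Omega R) {d : nat} (j : nat -> Omega -> 'I_d).
Hypothesis j_iid : iid_uniform P j.

Definition past (k : nat) (w : Omega) : {ffun 'I_k -> 'I_d} :=
  [ffun n : 'I_k => j n w].

Lemma past_inj_lt (k : nat) (w w' : Omega) :
  past k w = past k w' -> forall n, (n < k)%N -> j n w = j n w'.
Proof.
by move=> /ffunP E n nk; have := E (Ordinal nk); rewrite !ffunE.
Qed.

Lemma history_measurable (k : nat) (A : set Omega) :
  history j k A -> measurable A.
Proof.
have [mj _ _] := j_iid.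
apply: smallest_sub => [|_ [n [B [_ ->]]]]; last exact: mj.
exact: sigma_algebra_measurable.
Qed.

(** Preimages under [past k] form a sigma-algebra containing the generators. Conversely, [past k]
    has finite range, so each preimage is a finite union of finite intersections of generators. *)
Lemma history_preimage (k : nat) (A : set Omega) :
  history j k A <-> exists S, A = past k @^-1` S.
Proof.
split.
  apply: (smallest_sub (X := [set A | exists S, A = past k @^-1` S])).
    split=> [|_ [S ->]|A' /choice[S AS]].
    - by exists set0.
    - by exists (~` S); rewrite setTD.
    - exists (\bigcup_i S i); rewrite preimage_bigcup.
      by apply: eq_bigcupr => i _; rewrite AS.
  move=> _ [n [B [nk ->]]].
  exists [set t : {ffun 'I_k -> 'I_d} | B (t (Ordinal nk))].
  by apply/seteqP; split=> w /=; rewrite ffunE.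
pose gen := [set A : set Omega |
  exists n (B : set 'I_d), (n < k)%N /\ A = j n @^-1` B].
move=> [S ->]; pose M : measurableType _ := g_sigma_algebraType gen.
have -> : past k @^-1` S = \bigcup_(t in S) \bigcap_(n in [set: 'I_k])
    (j n @^-1` [set t n]).
  apply/seteqP; split=> [w Sw|w [t St tw]].
    by exists (past k w) => // n _ /=; rewrite ffunE.
  suff E : past k w = t by rewrite /= E.
  by apply/ffunP => n; rewrite ffunE tw.
apply: (@fin_bigcup_measurable _ M) => // t _.
apply: (@fin_bigcap_measurable _ M) => // n _.
by apply: sub_sigma_algebra; exists (n : nat), [set t n].
Qed.

Lemma past_fiber (k : nat) (t : {ffun 'I_k -> 'I_d}) :
  history j k (past k @^-1` [set t]).
Proof. by apply/history_preimage; exists [set t]. Qed.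

Lemma fresh_fiber (k : nat) (t : {ffun 'I_k -> 'I_d}) (i : 'I_d) :
  P (past k @^-1` [set t] `&` j k @^-1` [set i]) =
  (P (past k @^-1` [set t]) * (d%:R^-1)%:E)%E.
Proof.
have [_ uj indj] := j_iid.
(* One family serves both product rules: below [k] it cuts out the fiber of [t], and at [k] it is
   the singleton of [i]. *)
pose B n : set 'I_d := if insub n is Some m then [set t m] else [set i].
have pastE : past k @^-1` [set t] =
    \big[setI/setT]_(n <- iota 0 k) (j n @^-1` B n).
  rewrite -bigcap_seq; apply/seteqP; split=> w /=.
    move=> tw n /=; rewrite mem_iota /= /B => nk.
    by rewrite insubT /= -tw ffunE.
  move=> Hw; apply/ffunP => n; rewrite ffunE.
  have : B n (j n w) by apply: Hw; rewrite /= mem_iota /=.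
  by rewrite /B valK.
have Bk : B k = [set i] by rewrite /B insubF ?ltnn.
rewrite -(uj k i) pastE -Bk.
transitivity (P (\big[setI/setT]_(n <- rcons (iota 0 k) k) (j n @^-1` B n))).
  by rewrite big_rcons.
have kiota : k \notin iota 0 k by rewrite mem_iota ltnn.
rewrite !indj ?iota_uniq ?rcons_uniq ?kiota ?iota_uniq//.
by rewrite big_rcons.
Qed.

(** The type [S] may be infinite, but [s] factors through [past k]. Everything thus reduces to the
    finite-valued pair of [past k] and [j k], whose atoms have product mass by [fresh_fiber]. *)
Lemma is_condexp_fresh (k : nat) (S : Type) (s : Omega -> S)
    (phi : S -> 'I_d -> R) :
  (forall w w', (forall n, (n < k)%N -> j n w = j n w') -> s w = s w') ->
  is_condexp P (history j k) (fun w => phi (s w) (j k w))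
    (fun w => d%:R^-1 * \sum_(i < d) phi (s w) i).
Proof.
move=> s_past; have [mj _ _] := j_iid.
(* The default [point] on an empty fiber is harmless: [repE] evaluates [rep] only at [past k w],
   whose fiber contains [w]. *)
pose rep t := xget point (past k @^-1` [set t]).
have repE w : s (rep (past k w)) = s w.
  by apply: s_past; apply: past_inj_lt; rewrite /rep; case: xgetP => // /(_ w) [].
pose psi (t : {ffun 'I_k -> 'I_d}) i := phi (s (rep t)) i.
pose mean t := d%:R^-1 * \sum_(i < d) psi t i.
pose U w := (past k w, j k w).
have UE t i : U @^-1` [set (t, i)] =
    past k @^-1` [set t] `&` j k @^-1` [set i].
  by apply/seteqP; split=> w; rewrite /U /=; [move=> []|move=> [-> ->]].
have mpast t := history_measurable _ _ (past_fiber k t).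
have mU p : measurable (U @^-1` [set p]).
  by case: p => t i; rewrite UE; apply: measurableI; [exact: mpast|exact: mj].
have -> : (fun w => phi (s w) (j k w)) = (fun p => psi p.1 p.2) \o U.
  by apply/funext => w; rewrite /psi /= repE.
have -> : (fun w => d%:R^-1 * \sum_(i < d) phi (s w) i) = mean \o past k.
  by apply/funext => w; rewrite /mean /psi /= repE.
split.
- exact: integrable_finite_valued.
- exact: integrable_finite_valued.
- by move=> B _; apply/history_preimage; exists (mean @^-1` B).
move=> A hA; have mA := history_measurable _ _ hA.
(* [A] is a union of fibers of [past k]: the fiber of [t] either lies in [A], where [fresh_fiber]
   applies, or misses it, where both sides vanish. *)
have atom t i : P (U @^-1` [set (t, i)] `&` A) =
    (P (past k @^-1` [set t] `&` A) * (d%:R^-1)%:E)%E.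
  have [S' ->] := (history_preimage k A).1 hA; rewrite UE.
  have [St|St] := pselect (S' t).
    have sub : past k @^-1` [set t] `<=` past k @^-1` S' by move=> w /= ->.
    by rewrite setIAC (setIidl sub) fresh_fiber.
  by rewrite setIAC (_ : _ `&` past k @^-1` S' = set0) ?set0I ?measure0 ?mul0e//
       -subset0 => w /= [-> /St].
rewrite (integral_finite_valued P U mU (fun p => psi p.1 p.2))//.
rewrite (integral_finite_valued P (past k) mpast mean)//.
transitivity (\sum_t \sum_i (psi t i)%:E * P (U @^-1` [set (t, i)] `&` A))%E.
  by rewrite pair_bigA; apply: eq_bigr => -[t i].
apply: eq_bigr => t _; rewrite /mean.
have /fineK PA : P (past k @^-1` [set t] `&` A) \is a fin_num.
  by apply: fin_num_measure; exact: measurableI.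
rewrite -PA -EFinM mulr_sumr mulr_suml -sumEFin.
by apply: eq_bigr => i _; rewrite atom -PA -!EFinM; congr EFin; ring.
Qed.

End fresh_sample.

(** * Euclidean identities, and projection onto a singleton *)

Section euclidean.
Context {R : realType} {d : nat}.
Implicit Types u v : 'rV[R]_d.

Lemma dotp_ge0 u : 0 <= dotp u u.
Proof. by apply: sumr_ge0 => i _; rewrite -expr2 sqr_ge0. Qed.

Lemma sqr_enorm u : enorm u ^+ 2 = dotp u u.
Proof. by rewrite sqr_sqrtr ?dotp_ge0. Qed.

Lemma dotpDD u v : dotp (u + v) (u + v) = dotp u u + 2 * dotp u v + dotp v v.
Proof.
rewrite /dotp mulr_sumr -!big_split; apply: eq_bigr => i _ /=.
by rewrite !mxE; ring.
Qed.

(** Only coordinate [i] changes. Both SEGA updates are of this form, so both second moments rest on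
    this expansion. *)
Lemma sqr_enorm_addZ_delta u (c : R) (i : 'I_d) :
  enorm (u + c *: delta_mx ord0 i) ^+ 2 =
  enorm u ^+ 2 + (2 * c * u ord0 i + c ^+ 2).
Proof.
rewrite !sqr_enorm /dotp (bigD1 i) //= [\sum_(l < d) _ in RHS](bigD1 i) //=.
rewrite !mxE !eqxx /=.
under eq_bigr => l /negbTE li do rewrite !mxE li andbF mulr0 addr0.
by rewrite mulr1; ring.
Qed.

Lemma euclid_proj_set1 u v : euclid_proj [set u] v = u.
Proof.
rewrite /euclid_proj /argmin; case: xgetP => [y _ [] //|/(_ u) []].
by split=> // z ->.
Qed.

End euclidean.

(** * Moments of one SEGA step over a uniform coordinate *)

Section sega_moments.
Context {R : realType} {d : nat}.
Variables (F : 'rV[R]_d -> 'rV[R]_d) (x h c : 'rV[R]_d).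
Hypothesis d_gt0 : (0 < d)%N.

Let d_neq0 : (d%:R : R) != 0. Proof. by rewrite pnatr_eq0 -lt0n. Qed.

(** The factor [d] in the estimator cancels the weight 1/d of drawing [i], so the correction
    averages to [F x - h]. *)
Lemma sega_estimator_mean (i : 'I_d) :
  d%:R^-1 * \sum_(l < d) sega_estimator F x h l ord0 i = F x ord0 i.
Proof.
under eq_bigr do rewrite !mxE eqxx /=.
rewrite big_split /= sumr_const card_ord -[h ord0 i *+ d]mulr_natl.
rewrite (bigD1 i) //= big1 ?addr0 ?eqxx ?mulr1; last first.
  by move=> l /negbTE li; rewrite eq_sym li mulr0.
by rewrite -mulrDr subrK mulKf.
Qed.

Lemma sega_estimator_second_moment :
  d%:R^-1 * \sum_(l < d) enorm (sega_estimator F x h l - c) ^+ 2 =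
  d%:R * enorm (F x - c - (h - c)) ^+ 2 + 2 * dotp (F x - c - (h - c)) (h - c)
  + enorm (h - c) ^+ 2.
Proof.
(* Centring first puts the error in the form [h - c] plus a multiple of a basis vector. *)
under eq_bigr => l _ do
  rewrite /sega_estimator -addrA [_ + (h - c)]addrC sqr_enorm_addZ_delta.
rewrite big_split /= sumr_const card_ord -[enorm _ ^+ 2 *+ d]mulr_natl.
rewrite mulrDr mulKf// [LHS]addrC; congr (_ + _).
rewrite big_split /= mulrDr addrC sqr_enorm /dotp !mulr_sumr.
by congr (_ + _); apply: eq_bigr => l _; rewrite !mxE; field.
Qed.

(** Each coordinate of [h - c] is replaced by that of [F x - c] with weight 1/d and kept otherwise,
    whence the convex combination. *)
Lemma sega_h_step_second_moment :
  d%:R^-1 * \sum_(l < d) enorm (sega_h_step F x h l - c) ^+ 2 =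
  d%:R^-1 * enorm (F x - c) ^+ 2 + (1 - d%:R^-1) * enorm (h - c) ^+ 2.
Proof.
under eq_bigr => l _ do
  rewrite /sega_h_step addrAC sqr_enorm_addZ_delta.
rewrite big_split /= sumr_const card_ord -[enorm _ ^+ 2 *+ d]mulr_natl.
rewrite mulrDr mulKf// mulrBl mul1r addrCA; congr (_ + _).
rewrite -mulrBr; congr (_ * _); rewrite !sqr_enorm /dotp -sumrB.
by apply: eq_bigr => l _; rewrite !mxE; ring.
Qed.

Lemma sega_estimator_second_moment_le :
  d%:R^-1 * \sum_(l < d) enorm (sega_estimator F x h l - c) ^+ 2 <=
  2 * d%:R * enorm (F x - c) ^+ 2 + 2 * d%:R * enorm (h - c) ^+ 2.
Proof.
rewrite sega_estimator_second_moment.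
set a := F x - c; set b := h - c.
have d_ge1 : 1 <= d%:R :> R by rewrite ler1n.
have a_ge0 := dotp_ge0 a; have b_ge0 := dotp_ge0 b.
have sum_ge0 : 0 <= dotp (a + b) (a + b) := dotp_ge0 _.
have diff : dotp (a - b) (a - b) = dotp a a - 2 * dotp a b + dotp b b.
  rewrite /dotp mulr_sumr -sumrB -big_split; apply: eq_bigr => i _ /=.
  by rewrite !mxE; ring.
have cross : dotp (a - b) b = dotp a b - dotp b b.
  by rewrite /dotp -sumrB; apply: eq_bigr => i _; rewrite !mxE; ring.
rewrite !sqr_enorm diff cross; rewrite dotpDD in sum_ge0.
have : 0 <= (d%:R - 1) * (dotp a a + 2 * dotp a b + dotp b b).
  by rewrite mulr_ge0// subr_ge0.
by lra.
Qed.

End sega_moments.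

(** Sample [j k] first enters the state at [k.+1]; this supplies the hypothesis on [s] in
    [is_condexp_fresh]. *)
Lemma sega_state_past (R : realType) (d : nat) (F : 'rV[R]_d -> 'rV[R]_d)
    (r : 'rV[R]_d -> \bar R) (gamma : R) (x0 : 'rV[R]_d)
    (k : nat) (j j' : nat -> 'I_d) :
  (forall n, (n < k)%N -> j n = j' n) ->
  sega_state F r gamma x0 j k = sega_state F r gamma x0 j' k.
Proof.
elim: k => //= k IHk jj'.
by rewrite (IHk (fun n nk => jj' n (ltnW nk))) jj'.
Qed.

Theorem propositionH9 (R : realType) (d : nat)
    (F : 'rV[R]_d -> 'rV[R]_d) (r : 'rV[R]_d -> \bar R)
    (ell gamma : R) (x0 xs : 'rV[R]_d)
    (disp : measure_display) (Omega : measurableType disp)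
    (P : probability Omega R) (j : nat -> Omega -> 'I_d)
    (r_proper : proper_fun r) (r_lsc : lower_semicontinuous r)
    (r_convex : convex_efun r)
    (ell_gt0 : 0 < ell)
    (F_cocoercive : star_cocoercive F (vi_solutions F r) ell)
    (Xs_singleton : vi_solutions F r = [set xs])
    (gamma_gt0 : 0 < gamma)
    (j_iid : iid_uniform P j) :
  key_parametric_assumption P (history j) F (vi_solutions F r)
    (sega_x F r gamma x0 j) (sega_g F r gamma x0 j)
    (fun k w => enorm (sega_h F r gamma x0 j k w - F xs))
    (d%:R * ell) (2 * d%:R) (ell / (2 * d%:R)) 0 0 (d%:R^-1).
Proof.
(* [Omega] is pointed, so [j 0 point] is an element of ['I_d], which forces [d] to be positive. *)
have d_gt0 : (0 < d)%N := leq_ltn_trans (leq0n _) (ltn_ord (j 0%N point)).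
have dR_gt0 : 0 < d%:R :> R by rewrite ltr0n.
have cocoercive x : enorm (F x - F xs) ^+ 2 <= ell * dotp (F x - F xs) (x - xs).
  by have := F_cocoercive x; rewrite Xs_singleton /= euclid_proj_set1.
have condexp k (phi : 'rV[R]_d * 'rV[R]_d -> 'I_d -> R) :=
  is_condexp_fresh P j j_iid k _
    (fun w => sega_state F r gamma x0 (fun n => j n w) k) phi
    (fun w w' => @sega_state_past R d F r gamma x0 k _ _).
rewrite /key_parametric_assumption Xs_singleton.
split.
- have ell_ge0 := ltW ell_gt0.
  by split; rewrite ?(divr_ge0, mulr_ge0, ler0n).
- by rewrite invr_gt0 dR_gt0 invf_le1// ler1n.
- by move=> k w; rewrite sqrtr_ge0.
move=> k; split.
- move=> i; have := condexp k (fun s l => sega_estimator F s.1 s.2 l ord0 i).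
  congr (is_condexp _ _ _ _); apply/funext => w.
  exact: sega_estimator_mean.
(* The version of the conditional expectation is fixed by unification as the average over
   coordinates. *)
- eexists.
    have := condexp k (fun s l => enorm (sega_estimator F s.1 s.2 l - F xs) ^+ 2).
    congr (is_condexp _ _ _ _); apply/funext => w.
    by rewrite euclid_proj_set1.
  apply: aeW => w /=; rewrite euclid_proj_set1 addr0.
  apply: (le_trans (sega_estimator_second_moment_le _ _ _ _ d_gt0)).
  (* Scaling [cocoercive] by [2 * d] produces [2 * A] with [A = d * ell]; the terms in [h] already
     agree. *)
  rewrite lerD2r -!mulrA ler_pM2l// ler_pM2l//; exact: cocoercive.
- eexists.
    have := condexp k (fun s l => enorm (sega_h_step F s.1 s.2 l - F xs) ^+ 2).
    congr (is_condexp _ _ _ _); apply/funext => w.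
    by rewrite /sega_h /=; case: sega_state.
  apply: aeW => w /=; rewrite euclid_proj_set1 addr0.
  rewrite sega_h_step_second_moment// lerD2r.
  (* The 2 in the denominator of [C] offsets the factor [2 * C] of the assumption, leaving the 1/d
     of the moment times [ell]. *)
  have -> : 2 * (ell / (2 * d%:R)) = d%:R^-1 * ell :> R.
    by field; rewrite gt_eqF.
  by rewrite -mulrA ler_pM2l ?invr_gt0.
Qed.
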